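(* Let $X$ be a strongly cellular-Lindelöf, first countable, Hausdorff topological space. Then $X$ is weakly Lindelöf with respect to closed sets.
   Context: A space $X$ is Lindelöf if every open cover of $X$ has a countable subcover. A space $X$ is strongly cellular-Lindelöf if for every collection $\mathcal U$ of pairwise disjoint non-empty open subsets of $X$ there is a closed subspace $Y\subseteq X$ that is Lindelöf (in the subspace topology) and satisfies $Y\cap U\neq\emptyset$ for each $U\in\mathcal U$. A space $X$ is weakly Lindelöf with respect to closed sets if for every closed set $F\subseteq X$ and every collection $\mathcal U$ of open subsets of $X$ with $F\subseteq\bigcup\mathcal U$ there is a countable subcollection $\mathcal V\subseteq\mathcal U$ such that $F\subseteq\overline{\bigcup\mathcal V}$. *)

(* Defs.v *)
From mathcomp Require Import all_boot all_classical topology.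

Set Implicit Arguments.
Unset Strict Implicit.
Unset Printing Implicit Defensive.

Local Open Scope classical_set_scope.

Definition lindelof (T : topologicalType) : Prop :=
  forall U : set (set T), U `<=` open -> [set: T] `<=` \bigcup_(A in U) A ->
  exists V : set (set T),
    [/\ V `<=` U, countable V & [set: T] `<=` \bigcup_(A in V) A].

(* [set_type Y] is [Y] with the initial topology of the inclusion, i.e. the
   subspace topology ([subspace Y] would keep the points outside [Y]). *)
Definition strongly_cellular_lindelof (T : topologicalType) : Prop :=
  forall U : set (set T),
    U `<=` open -> (forall A, U A -> A !=set0) -> trivIset U id ->
  exists Y : set T,
    [/\ closed Y, lindelof (set_type Y) & forall A, U A -> Y `&` A !=set0].

Definition weakly_lindelof_closed (T : topologicalType) : Prop :=
  forall (F : set T) (U : set (set T)),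
    closed F -> U `<=` open -> F `<=` \bigcup_(A in U) A ->
  exists V : set (set T),
    [/\ V `<=` U, countable V & F `<=` closure (\bigcup_(A in V) A)].

Definition first_countable (T : topologicalType) : Prop :=
  forall x : T, exists B : set (set T),
    [/\ countable B, B `<=` nbhs x &
        forall N, nbhs x N -> exists2 A, B A & A `<=` N].

(* Main.v *)
Require Import Defs.
From mathcomp Require Import all_boot all_classical wochoice topology.

(** Why the theorem holds.  Suppose that no countable part of the open family
    [U] covers the closed set [F] up to closure.  Then every countable part [V]
    of [U] misses a point of [F], even up to closure, so one can choose
    [omega_1] many points [x i] of [F] such that [x i] lies off the closure of
    the union of the countable family [hist x i] built from the earlier
    points.  That family contains, for each [j] below [i],
    - a member [U0 (x j)] of [U] around [x j], and
    - countably many members of [U] that cover the closure of the points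
      [x k], [k <= j], as soon as such a countable cover exists.

    The first item makes the sets
    [W i := U0 (x i) `&` ~` closure (\bigcup_(A in hist x i) A)]
    pairwise disjoint neighbourhoods of the [x i].  The key point is that a
    disjoint expansion of a family of points puts all of them in one closed
    Lindelof set [Y] ([lindelof_superset_of_disjoint_expansion]): inside each
    [W i] there is a sequence of disjoint open sets converging to [x i]
    ([cellular_family_at]; here first countability and Hausdorffness enter),
    and a closed set that meets all members of these sequences contains the
    [x i].  Hence the closure of any set of points [x i] is Lindelof, being
    closed in [Y], and it lies in [F], so the countable covers of the second
    item do exist.

    By first countability each point of the closure of the whole family is in
    the closure of countably many [x i], hence of an initial segment of them.
    So that closure is covered by the members of all the [hist x i], and by
    Lindelofness by countably many of these, which all belong to a single
    [hist x d].  But [x d] is not covered by [hist x d]: a contradiction. *)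

Set Implicit Arguments.
Unset Strict Implicit.
Unset Printing Implicit Defensive.
Local Open Scope classical_set_scope.

(** * Recursion of length omega_1 *)

Lemma countable_setU (T : Type) (A B : set T) :
  countable A -> countable B -> countable (A `|` B).
Proof.
move=> Ac Bc; have -> : A `|` B = \bigcup_(b in [set: bool]) if b then A else B.
  apply/seteqP; split=> [x [Ax|Bx]|x [[] _ ?]]; [by exists true|by exists false| |].
    by left.
  by right.
by apply: bigcup_countable => // -[].
Qed.

(** The order is that of [omega_1]: well-order [T] and keep the points that have
    countably many predecessors.  They are uncountably many, since otherwise
    the least point left out would have countably many predecessors.  A
    countable set [C] of them is then strictly bounded, because the points
    below or in [C] form a countable set. *)
Lemma exists_omega1_order (T : eqType) : ~ countable [set: T] ->
  exists (I : Type) (lt : I -> I -> Prop),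
    [/\ well_founded lt,
        forall i j k, lt i j -> lt j k -> lt i k,
        forall i j, [\/ lt i j, i = j | lt j i],
        forall i, countable [set j | lt j i] &
        forall C : set I, countable C -> exists i, forall j, C j -> lt j i].
Proof.
move=> Tunc; have [R Rwo] := well_ordering_principle T.
have minR (A : set T) : A !=set0 -> exists2 m, A m & forall x, A x -> R m x.
  move=> [a Aa]; have [|m [[/= mA lbm] _]] := Rwo [pred x | x \in A].
    by exists a; rewrite !inE.
  exists m; first by apply/set_mem.
  by move=> x Ax; apply: lbm; exact: mem_set.
(* [well_order] speaks of minima only; it is a total order because the
   two- and three-element sets have minima. *)
have RwoT : wo_chain R predT by move=> A _; exact: Rwo.
have Rtot x y : R x y || R y x by exact: (wo_chainW RwoT).
have Ranti x y : R x y -> R y x -> x = y.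
  by move=> xy yx; apply: (wo_chain_antisymmetric RwoT) => //; rewrite xy yx.
have Rtrans x y z : R x y -> R y z -> R x z.
  move=> xy yz.
  have [|m + lbm] := minR [set x; y; z]; first by exists x; left; left.
  have [mx my mz] : [/\ R m x, R m y & R m z].
    by split; apply: lbm; [left; left|left; right|right].
  move=> [[|]|] /= mE; rewrite {}mE in mx my mz => //.
    by rewrite (Ranti _ _ xy mx).
  by rewrite -(Ranti _ _ yz my).
pose ltT x y := ~~ R y x.
have ltT_trans x y z : ltT x y -> ltT y z -> ltT x z.
  move=> xy /negP yz; apply/negP => zx; apply: yz; apply: Rtrans zx _.
  by have := Rtot x y; rewrite (negbTE xy) orbF.
have ltT_total x y : [\/ ltT x y, x = y | ltT y x].
  have [|] := boolP (R y x); last by constructor 1.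
  have [|] := boolP (R x y); last by constructor 3.
  by move=> xy yx; constructor 2; exact: Ranti.
pose A := [set t | countable [set s | ltT s t]].
(* [A] is the initial segment of [T] of type omega_1. *)
have Aunc : ~ countable A.
  move=> Ac; have [AT|/existsNP] := pselect (forall t, A t).
    by apply: Tunc; apply: sub_countable Ac; apply: subset_card_le => t _.
  move=> /minR[m nAm lbm]; apply: nAm; apply: sub_countable Ac.
  apply: subset_card_le => s /= /negP sm; apply: contrapT => nAs.
  by apply: sm; exact: lbm.
pose lt (i j : A) : Prop := ltT (val i) (val j).
have val_count (S : set A) : countable (val @` S) -> countable S.
  have finj : {in S &, injective (val : A -> T)} by move=> i j _ _; apply: val_inj.
  by rewrite (eq_countable (inj_card_eq finj)).
have seg i : countable [set j | lt j i].
  apply: val_count; have := set_mem (valP i); apply: sub_countable.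
  by apply: subset_card_le => _ [j ji <-].
exists A, lt; split.
- apply: contrapT => /existsNP[i0 i0N].
  have [|m mN minm] := minR (val @` [set i | ~ Acc lt i]); first by exists (val i0), i0.
  case: mN minm => i iN <- minm; apply: iN; constructor => j /negP ji.
  by apply: contrapT => jN; apply: ji; apply: minm; exists j.
- by move=> i j k; exact: ltT_trans.
- move=> i j; have [h|/val_inj h|h] := ltT_total (val i) (val j);
    by [constructor 1|constructor 2|constructor 3].
- exact: seg.
- move=> C Cc; apply: contrapT => Cunb; apply: Aunc.
  have : countable (val @` \bigcup_(j in C) ([set j] `|` [set k | lt k j])).
    apply: sub_countable (card_image_le _ _) _.
    by apply: bigcup_countable => // j _; apply: countable_setU (countable1 _) (seg j).
  apply: sub_countable; apply: subset_card_le => t At.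
  exists (exist _ t (mem_set At)) => //; apply: contrapT => tN; apply: Cunb.
  exists (exist _ t (mem_set At)) => j Cj.
  have [//|ji|tj] := ltT_total (val j) t.
    by case: tN; exists j => //; left; exact: val_inj.
  by case: tN; exists j => //; right.
Qed.

(** [Fix] phrased for a step function that takes a total [I -> X]: the
    hypothesis on [G] says that the step at [i] only looks below [i], and [x0]
    is a junk value used where it does not look. *)
Lemma wf_recursion (I X : Type) (lt : I -> I -> Prop) (x0 : X)
    (G : I -> (I -> X) -> X) : well_founded lt ->
  (forall i f g, (forall j, lt j i -> f j = g j) -> G i f = G i g) ->
  exists f, forall i, f i = G i f.
Proof.
move=> wf Gext.
pose restr i (rec : forall j, lt j i -> X) j :=
  if pselect (lt j i) is left ji then rec j ji else x0.
exists (Fix wf (fun=> X) (fun i rec => G i (restr i rec))) => i.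
rewrite Fix_eq; last first.
  move=> k f g fg; congr (G k _); apply/funext => j; rewrite /restr.
  by case: pselect.
by apply: Gext => j ji; rewrite /restr; case: pselect.
Qed.

(** * Lindelof and first countable spaces *)

(** Adding the complement of [C] to [U] gives a cover of the whole subspace [Y];
    in the countable subcover that results, only members of [U] can contain
    points of [C]. *)
Lemma lindelof_closed_cover (X : topologicalType) (Y C : set X)
    (U : set (set X)) :
  lindelof (set_type Y) -> closed C -> C `<=` Y ->
  U `<=` open -> C `<=` \bigcup_(A in U) A ->
  exists V : set (set X), [/\ V `<=` U, countable V & C `<=` \bigcup_(A in V) A].
Proof.
move=> LY Ccl CY Uop Ucov.
pose U' := U `|` [set ~` C].
pose tr (A : set X) : set (set_type Y) := val @^-1` A.
have [||V [VU Vc Vcov]] := LY (tr @` U').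
- move=> _ [A AU <-]; exists A => //.
  by case: AU => [/Uop//|->]; exact: closed_openC.
- move=> y _; have [Cy|nCy] := pselect (C (val y)).
    by have [A AU Ay] := Ucov _ Cy; exists (tr A) => //; exists A => //; left.
  by exists (tr (~` C)) => //; exists (~` C) => //; right.
have /choice[g gP] : forall B, exists A, V B -> U' A /\ tr A = B.
  move=> B.
  have [VB|nVB] := pselect (V B); last by exists set0.
  by have [A AU AB] := VU _ VB; exists A.
(* Intersecting with [U] discards the complement of [C], unless it is itself a
   member of [U]. *)
exists (g @` V `&` U); split; first by move=> A [].
  apply: sub_countable Vc; apply: card_le_trans (card_image_le g V).
  by apply: subset_card_le => A [].
move=> x Cx; have Yx := CY _ Cx.
have [B VB By] := Vcov (exist _ x (mem_set Yx)) I.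
have [gU gB] := gP _ VB; rewrite -gB /tr/= in By.
exists (g B) => //; split; first by exists B.
by case: gU => // gE; rewrite gE in By.
Qed.

Lemma first_countable_seq (X : topologicalType) (x : X) : first_countable X ->
  exists B : nat -> set X, (forall n, nbhs x (B n)) /\
    forall N, nbhs x N -> exists n, B n `<=` N.
Proof.
move=> /(_ x)[B [/countable_injP[f finj] Bx Bbase]].
pose P n := [set A | B A /\ f A = n].
exists (fun n => xget setT (P n)); split=> [n|N /Bbase[A BA AN]].
  by case: xgetP => [A _ [/Bx//]|_]; exact: filterT.
exists (f A); case: xgetP => [A' _ [BA' fA']|/(_ A) nPA].
  by rewrite (finj A' A) // ?inE.
by case: nPA; split.
Qed.

Lemma closure_first_countable (X : topologicalType) (D : set X) (x : X) :
  first_countable X -> closure D x ->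
  exists s : nat -> X, range s `<=` D /\ closure (range s) x.
Proof.
move=> fc Dx; have [B [Bx Bbase]] := first_countable_seq x fc.
have /choice[s sP] : forall n, exists y, (D `&` B n) y by move=> n; exact: Dx.
exists s; split=> [_ [n _ <-]|N /Bbase[n BN]]; first by have [] := sP n.
by exists (s n); split; [exists n|apply: BN; have [] := sP n].
Qed.

(** * Disjoint expansions and closed Lindelof sets *)

(** If [x] is isolated, take [[set x]].  Otherwise construct disjoint open sets
    [O n] that converge to [x]: every neighbourhood of [x] contains a point
    other than [x], and by separation of these two points it splits into a
    nonempty open set, which is the next [O n], and a smaller neighbourhood of
    [x] disjoint from it, inside which the construction goes on. *)
Lemma cellular_family_at (X : topologicalType) (x : X) (W : set X) :
  first_countable X -> hausdorff_space X -> open_nbhs x W ->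
  exists O : set (set X),
    [/\ O `<=` open, forall A, O A -> A !=set0, trivIset O id,
        forall A, O A -> A `<=` W &
        forall Y, closed Y -> (forall A, O A -> Y `&` A !=set0) -> Y x].
Proof.
move=> fc; rewrite open_hausdorff => T2 [Wop Wx].
have [xop|xnop] := pselect (open [set x]).
  exists [set [set x]]; split.
  - by move=> _ ->.
  - by move=> _ ->; exists x.
  - by move=> _ _ -> ->.
  - by move=> _ -> _ ->.
  - by move=> Y _ /(_ _ erefl)[y [Yy xy]]; rewrite xy in Yy.
have [B [Bx Bbase]] := first_countable_seq x fc.
have /choice[split splitP] : forall N, exists p : set X * set X, nbhs x N ->
    [/\ open p.1, p.1 !=set0, nbhs x p.2, p.1 `|` p.2 `<=` N &
        p.1 `&` p.2 = set0].
  move=> N; have [Nx|nNx] := pselect (nbhs x N); last by exists (set0, set0).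
  have [y Ny yx] : exists2 y, N^° y & x != y.
    apply: contrapT => Nx1; apply: xnop.
    suff -> : [set x] = N^° by exact: open_interior.
    apply/seteqP; split=> [_ ->|y Ny]; first exact: Nx.
    by apply: contrapT => /eqP yx; apply: Nx1; exists y; rewrite // eq_sym.
  have [[P Q] /= [/set_mem Px /set_mem Qy] [Pop Qop /eqP PQ0]] := T2 _ _ yx.
  exists (Q `&` N^°, P `&` N); split=> /=.
  - by apply: openI => //; exact: open_interior.
  - by exists y.
  - by apply: filterI => //; exact: open_nbhs_nbhs.
  - by move=> z [[_ /interior_subset]|[]].
  - by apply/seteqP; split=> // z [[Qz _] [Pz _]]; rewrite -PQ0; split.
(* [N n] is what is left for the sets [O m], [m >= n]; intersecting with the
   basic neighbourhood [B n] forces convergence to [x]. *)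
pose N := fix N n := if n is n'.+1 then (split (N n' `&` B n')).2 else W.
have Nx n : nbhs x (N n).
  elim: n => [|n IH] /=; first exact: open_nbhs_nbhs.
  by have [] := splitP (N n `&` B n) (filterI IH (Bx n)).
have NBx n : nbhs x (N n `&` B n) by exact: filterI.
have sP n := splitP _ (NBx n).
pose O n := (split (N n `&` B n)).1.
have NS n : N n.+1 `<=` N n.
  by have [_ _ _ + _] := sP n => sub z Nz; have [] := sub z (or_intror Nz).
have Nmono m n : (m <= n)%N -> N n `<=` N m.
  move=> /subnK <-; elim: (n - m)%N => [|k IH] //.
  by rewrite addSn; apply: subset_trans IH; exact: NS.
have ON n : O n `<=` N n `&` B n.
  by have [_ _ _ + _] := sP n => sub z Oz; apply: sub; left.
have disj m n z : (m < n)%N -> O m z -> O n z -> False.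
  move=> /Nmono mn Omz /ON[/mn Nz _].
  have [_ _ _ _ E] := sP m.
  by suff : set0 z by []; rewrite -E; split.
exists (range O); split.
- by move=> _ [n _ <-]; have [] := sP n.
- by move=> _ [n _ <-]; have [] := sP n.
- move=> _ _ [m _ <-] [n _ <-] [z [Om On]]; congr O.
  by case: (ltngtP m n) => // mn;
    [have := disj _ _ _ mn Om On|have := disj _ _ _ mn On Om].
- by move=> _ [n _ <-] z /ON[/(Nmono 0%N) + _]; exact.
- move=> Y Ycl YO; apply: Ycl => M /Bbase[n BM].
  have [|z [Yz Oz]] := YO (O n); first by exists n.
  by exists z; split=> //; apply: BM; have [] := ON _ _ Oz.
Qed.

(** Strong cellularity alone gives a closed Lindelof set that meets every [W i].
    To catch the points [x i], apply it to the disjoint families of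
    [cellular_family_at] inside the [W i]. *)
Lemma lindelof_superset_of_disjoint_expansion (X : topologicalType) (I : Type)
    (x : I -> X) (W : I -> set X) :
  strongly_cellular_lindelof X -> first_countable X -> hausdorff_space X ->
  (forall i, open_nbhs (x i) (W i)) -> trivIset [set: I] W ->
  exists Y : set X, [/\ closed Y, lindelof (set_type Y) & range x `<=` Y].
Proof.
move=> scl fc T2 Wx Wdisj.
have /choice[O OP] := fun i => cellular_family_at fc T2 (Wx i).
have [|||Y [Ycl LY YO]] := scl (\bigcup_i O i).
- by move=> A [i _]; have [+ _ _ _ _] := OP i; exact.
- by move=> A [i _]; have [_ + _ _ _] := OP i; exact.
- move=> A B [i _ OA] [j _ OB] AB.
  have [_ _ Otriv OW _] := OP i; have [_ _ _ OW' _] := OP j.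
  have ij : i = j.
    apply: Wdisj => //; apply: subset_nonempty AB.
    by apply: setISS; [exact: OW|exact: OW'].
  by apply: Otriv => //; rewrite ij.
exists Y; split=> // _ [i _ <-]; have [_ _ _ _ +] := OP i; apply=> // A OA.
by apply: YO; exists i.
Qed.

(** * Closed sets are weakly covered by countable subfamilies *)

Theorem theorem3 (X : topologicalType)
    (hscl : strongly_cellular_lindelof X)
    (hfc : first_countable X)
    (hT2 : hausdorff_space X) :
  weakly_lindelof_closed X.
Proof.
move=> F U Fcl Uop Ucov; apply: contrapT => noV.
have pickP (V : set (set X)) : V `<=` U -> countable V ->
    exists p, F p /\ ~ closure (\bigcup_(A in V) A) p.
  move=> VU Vc; apply: contrapT => noP; apply: noV; exists V; split=> // p Fp.
  by apply: contrapT => np; apply: noP; exists p.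
have [p0 [Fp0 _]] := pickP set0 (@sub0set _ _) (countable0 _).
have /choice[pick pickE] : forall V : set (set X), exists p,
    F p /\ (V `<=` U -> countable V -> ~ closure (\bigcup_(A in V) A) p).
  move=> V; have [[/pickP/[apply][[p [Fp ?]]]]|nV] := pselect (V `<=` U /\ countable V).
    by exists p.
  by exists p0; split=> // VU Vc; case: nV.
have /choice[U0 U0P] : forall p, exists A, F p -> U A /\ A p.
  move=> p; have [/Ucov[A UA Ap]|nFp] := pselect (F p); first by exists A.
  by exists set0.
(* If [X] were countable, so would be [U0 @` F], which covers [F]. *)
have Xunc : ~ countable [set: X].
  move=> Xc; have [Fp] := pickE (U0 @` F); apply.
  - by move=> _ [p /U0P[? _] <-].
  - apply: sub_countable (card_image_le _ _) _; apply: sub_countable Xc.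
    exact: card_leT.
  have [_ Up] := U0P _ Fp; apply: subset_closure.
  by exists (U0 (pick (U0 @` F))) => //; exists (pick (U0 @` F)).
have [I [lt [wf lt_trans lt_total segc bounded]]] := exists_omega1_order Xunc.
pose subcover (A : set X) (V : set (set X)) :=
  [/\ V `<=` U, countable V & closure A `<=` \bigcup_(B in V) B].
(* The points are chosen before it is known that countable covers of the
   closures exist, so [psi] has to be total. *)
have /choice[psi psiP] : forall A : set X, exists V : set (set X),
    [/\ V `<=` U, countable V & (exists V', subcover A V') -> subcover A V].
  move=> A; have [[V VA]|nV] := pselect (exists V, subcover A V).
    by exists V; case: (VA) => VU Vc _; split.
  by exists set0; split.
pose phi A := U0 @` A `|` psi A.
pose upto (i : I) := [set i] `|` [set j | lt j i].
have uptoc i : countable (upto i) by exact: countable_setU (countable1 _) (segc i).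
pose hist (f : I -> X) i := \bigcup_(j in [set j | lt j i]) phi (f @` upto j).
have [x xE] : exists x, forall i, x i = pick (hist x i).
  apply: (wf_recursion p0 wf) => i f g fg; congr pick.
  apply: eq_bigcupr => j ji; congr phi.
  apply: eq_imagel => k [->|kj]; apply: fg => //.
  exact: lt_trans kj ji.
have xF i : F (x i) by rewrite xE; have [] := pickE (hist x i).
have phiU i : phi (x @` upto i) `<=` U.
  move=> A [[_ [j _ <-] <-]|psiA]; first by have [] := U0P _ (xF j).
  by have [+ _ _] := psiP (x @` upto i); apply.
have histU i : hist x i `<=` U by move=> A [j _ /phiU].
have histc i : countable (hist x i).
  apply: bigcup_countable => // j _; apply: countable_setU.
    apply: sub_countable (card_image_le _ _) _.
    exact: sub_countable (card_image_le _ _) (uptoc j).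
  by have [] := psiP (x @` upto j).
(* From here on, the recursion equation is used only through [x_off]. *)
have x_off i : ~ closure (\bigcup_(A in hist x i) A) (x i).
  by rewrite [X in ~ closure _ X]xE; have [_] := pickE (hist x i); apply.
pose W i := U0 (x i) `&` ~` closure (\bigcup_(A in hist x i) A).
have Wx i : open_nbhs (x i) (W i).
  have [UU0 U0x] := U0P _ (xF i); split; last by split=> //; exact: x_off.
  by apply: openI; [exact: Uop|apply: closed_openC; exact: closed_closure].
have Wlt i j z : lt i j -> W i z -> W j z -> False.
  move=> ij [U0z _] [_]; apply; apply: subset_closure.
  exists (U0 (x i)) => //; exists i => //; left.
  by exists (x i) => //; exists i => //; left.
have Wdisj : trivIset [set: I] W.
  move=> i j _ _ [z [Wi Wj]]; have [ij|//|ji] := lt_total i j.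
    by case: (Wlt _ _ _ ij Wi Wj).
  by case: (Wlt _ _ _ ji Wj Wi).
have [Y [Ycl LY DY]] :=
  lindelof_superset_of_disjoint_expansion hscl hfc hT2 Wx Wdisj.
have subY (A : set X) : A `<=` range x -> closure A `<=` Y.
  by move=> AD; rewrite closureE; apply: smallest_sub Ycl (subset_trans AD DY).
have subF (A : set X) : A `<=` range x -> closure A `<=` F.
  move=> AD; rewrite closureE; apply: (smallest_sub Fcl) => _ /AD[i _ <-]; exact: xF.
(* Only now, with the [x i] trapped in [Y], is [psi] known to return covers. *)
have psi_cov i : closure (x @` upto i) `<=` \bigcup_(A in phi (x @` upto i)) A.
  have AD : x @` upto i `<=` range x by move=> _ [j _ <-]; exists j.
  have [_ _ ] := psiP (x @` upto i); case=> [|_ _ cov p /cov[A pA Ap]].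
    apply: (lindelof_closed_cover LY) => //; first exact: closed_closure.
      exact: subY.
    by apply: subset_trans Ucov; exact: subF.
  by exists A => //; right.
have [V [VH Vc Vcov]] : exists V, [/\ V `<=` \bigcup_i phi (x @` upto i),
    countable V & closure (range x) `<=` \bigcup_(A in V) A].
  apply: (lindelof_closed_cover LY) => //.
  - exact: closed_closure.
  - exact: subY.
  - by move=> A [i _ /phiU/Uop].
  (* A sequence of points [x i] that accumulates at [p] has bounded indices. *)
  move=> p /(closure_first_countable hfc)[s [sD sp]].
  have /choice[idx idxP] : forall n, exists i, x i = s n.
    by move=> n; have [i _ <-] := sD (s n) (ex_intro2 _ _ n Logic.I erefl); exists i.
  have [i iP] := bounded (range idx) (sub_countable (card_image_le _ _) (countableP _)).
  have [|A phiA Ap] := psi_cov i p.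
    apply: closureS sp => _ [n _ <-]; exists (idx n) => //.
    by right; apply: iP; exists n.
  by exists A => //; exists i.
have /choice[idx idxP] : forall A, exists i, V A -> phi (x @` upto i) A.
  have [i0 _] := bounded set0 (countable0 _).
  move=> A; have [/VH[i _ ?]|nVA] := pselect (V A); first by exists i.
  by exists i0.
have [d dP] := bounded (idx @` V) (sub_countable (card_image_le _ _) Vc).
have [|A VA Ad] := Vcov (x d); first by apply: subset_closure; exists d.
apply: (x_off d); apply: subset_closure; exists A => //; exists (idx A).
  by apply: dP; exists A.
exact: idxP.
Qed.
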